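(* For any finite field $\mathbb F_{p^m}$ ($p$ prime, $m\ge 1$), the semigroup $LCAT(\mathbb F_{p^m}^{\mathbb N})$ is maximal commutative.
   Context: $\mathbb N$ includes $0$. $\mathbb F_{p^m}$ is the field with $p^m$ elements (discrete topology), and $\mathbb F_{p^m}^{\mathbb N}$ is the space of one-sided sequences $a=a_0a_1a_2\dots$ over it, with the product topology and its coordinatewise $\mathbb F_{p^m}$-vector space structure. $\sigma$ is the left shift, $\sigma(a)_k=a_{k+1}$. $CAT(\mathbb F_{p^m}^{\mathbb N})$ is the semigroup (under composition) of all continuous maps $\tau:\mathbb F_{p^m}^{\mathbb N}\to\mathbb F_{p^m}^{\mathbb N}$ with $\tau\sigma=\sigma\tau$, and $LCAT(\mathbb F_{p^m}^{\mathbb N})$ is the sub-semigroup of those elements that are $\mathbb F_{p^m}$-linear. A semigroup $\Sigma\subset CAT(\mathbb F_{p^m}^{\mathbb N})$ is maximal commutative (MC) if (1) $\Sigma$ is commutative, and (2) every $\mu\in CAT(\mathbb F_{p^m}^{\mathbb N})$ with $\mu\tau=\tau\mu$ for all $\tau\in\Sigma$ belongs to $\Sigma$. *)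

(* Defs.v *)
From HB Require Import structures.
From mathcomp Require Import all_boot all_order all_algebra all_field.
From mathcomp Require Import all_classical topology.

Set Implicit Arguments.
Unset Strict Implicit.
Unset Printing Implicit Defensive.

Import GRing.Theory.

Local Open Scope classical_set_scope.
Local Open Scope ring_scope.

Definition config (F : finFieldType) : topologicalType :=
  {ptws nat -> discrete_topology F}.

Definition shift (F : finFieldType) (a : config F) : config F :=
  fun k => a k.+1.

Definition CAT (F : finFieldType) : set (config F -> config F) :=
  [set tau | continuous tau /\ tau \o @shift F = @shift F \o tau].

(* [config F] unfolds to [nat -> F]; linearity is read in the pointwise
   [F]-module structure that the library puts on [nat -> F^o]. *)
Definition LCAT (F : finFieldType) : set (config F -> config F) :=
  [set tau | @CAT F tau /\ linear (tau : (nat -> F^o) -> (nat -> F^o))].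

Definition semigroup (T : Type) (Sigma : set (T -> T)) : Prop :=
  forall tau mu, Sigma tau -> Sigma mu -> Sigma (tau \o mu).

Definition commutative_family (T : Type) (Sigma : set (T -> T)) : Prop :=
  forall tau mu, Sigma tau -> Sigma mu -> tau \o mu = mu \o tau.

Definition maximal_commutative (F : finFieldType)
    (Sigma : set (config F -> config F)) : Prop :=
  [/\ Sigma `<=` @CAT F,
      semigroup Sigma,
      commutative_family Sigma &
      forall mu, @CAT F mu ->
        (forall tau, Sigma tau -> mu \o tau = tau \o mu) -> Sigma mu].

(* Main.v *)
(** A linear cellular automaton is a polynomial in the shift, so a linear map
    commuting with the shift commutes with it.  Conversely, let [mu] commute
    with every linear automaton.  For [u], [v] and [j] let [w] be the first
    [j] letters of [u] followed by [v].  Applying [mu] to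
    [c w + sigma^j w], which agrees with [c u + v] on the first [j] letters,
    gives [c mu(w) + mu(v)]; for [j] large, continuity replaces [w] by [u] and
    [c w + sigma^j w] by [c u + v]. *)

Require Import Defs.
From mathcomp Require Import all_boot all_order all_algebra all_field.
From mathcomp Require Import all_classical topology.

Set Implicit Arguments.
Unset Strict Implicit.
Unset Printing Implicit Defensive.

Import GRing.Theory.

Local Open Scope classical_set_scope.

Lemma nbhs_configP (F : finFieldType) (a : config F) (A : set (config F)) :
  nbhs a A <->
  exists N, forall b : config F, (forall i, i < N -> b i = a i) -> A b.
Proof.
split=> [|[N]]; last first.
  move=> cylA; apply: (@filterS _ (nbhs a) _
    [set b : config F | forall i, i < N -> b i = a i]) => //.
  elim: N {A cylA} => [|N IH]; first by apply: filterS filterT => b _ i.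
  have nbhsN : nbhs a [set b : config F | b N = a N].
    exact: (@proj_continuous nat (fun=> discrete_topology F) N a [set a N]
      (@discrete_set1 (discrete_topology F) (a N))).
  apply: filterS (filterI IH nbhsN) => b [eqb eqN] i.
  by rewrite ltnS leq_eqVlt => /predU1P[->|/eqb].
(* The sets containing a cylinder around [a] form a filter. It converges to [a] in each coordinate,
   hence in the product topology, and this convergence says precisely that every neighbourhood of
   [a] lies in [G]. *)
pose G : set_system (config F) := [set B | exists N,
  forall b : config F, (forall i, i < N -> b i = a i) -> B b].
have FG : Filter G.
  split=> [|P Q [M MP] [N NQ]|P Q PQ [N NP]]; first by exists 0.
    exists (maxn M N) => b eqb; split.
      by apply: MP => i iM; apply: eqb; rewrite leq_max iM.
    by apply: NQ => i iN; apply: eqb; rewrite leq_max iN orbT.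
  by exists N => b /NP /PQ.
suff : G --> (a : {ptws nat -> discrete_topology F}) by apply.
apply/pointwise_cvgP => t B /nbhs_singleton Bat.
by exists t.+1 => b eqb; rewrite /= eqb.
Qed.

(** A neighbourhood of [tau a] constrains only finitely many letters, and the finitely many
    neighbourhoods of [a] controlling them one by one can be intersected. *)
Lemma continuous_configP (F : finFieldType) (tau : config F -> config F) :
  continuous tau <->
  forall (a : config F) k, exists N, forall b : config F,
    (forall i, i < N -> b i = a i) -> tau b k = tau a k.
Proof.
split=> [ctau a k|loc a B /nbhs_configP[N NB]].
  have /ctau/nbhs_configP : nbhs (tau a) [set b : config F | b k = tau a k].
    by apply/nbhs_configP; exists k.+1 => b; apply.
  by [].
have near_eq k : nbhs a [set b : config F | tau b k = tau a k].
  exact/nbhs_configP/loc.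
suff H : nbhs a [set b | forall i, i < N -> tau b i = tau a i].
  by apply: filterS H => b /NB.
elim: N {NB} => [|N IH]; first by apply: filterS filterT => b _ i.
apply: filterS (filterI IH (near_eq N)) => b [eqb eqN] i.
by rewrite ltnS leq_eqVlt => /predU1P[->|/eqb].
Qed.

Lemma CAT_shift (F : finFieldType) (tau : config F -> config F) j a k :
  CAT tau -> tau a (k + j) = tau (fun i => a (i + j)) k.
Proof.
case=> _ tauS; elim: j a => [|j IH] a.
  by rewrite addn0; congr (tau _ k); apply/funext => i; rewrite addn0.
have -> : tau a (k + j.+1) = tau (shift a) (k + j).
  by rewrite addnS -[RHS]/((tau \o @shift F) a (k + j)) tauS.
by rewrite IH; congr (tau _ k); apply/funext => i; rewrite addnS.
Qed.

Local Open Scope ring_scope.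

Lemma linear_lincomb (R : pzRingType) (U V : lmodType R) (f : U -> V) :
  linear f -> forall (I : Type) (r : seq I) (c : I -> R) (u : I -> U),
  f (\sum_(i <- r) c i *: u i) = \sum_(i <- r) c i *: f (u i).
Proof.
move=> lf I r c u; elim: r => [|i r IH]; last by rewrite !big_cons lf IH.
(* The scalar [-1] at the zero vectors turns linearity into [f 0 = - f 0 + f 0], so [f 0 = 0]. *)
by have := lf (-1) 0 0; rewrite !big_nil scaler0 addr0 scaleN1r addNr.
Qed.

Lemma LCAT_poly_shift (F : finFieldType) (tau : config F -> config F) :
  LCAT tau -> exists N (c : nat -> F), forall a : config F,
    tau a = \sum_(0 <= i < N) c i *: ((fun k => a (k + i)%N) : nat -> F^o).
Proof.
(* Continuity is used at the zero sequence alone; linearity will carry the window [N] found there to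
   every other sequence. *)
move=> [tauC tauL]; have /continuous_configP/(_ (fun=> 0) 0%N)[N tauN] := tauC.1.
pose e i : nat -> F^o := fun k => (k == i)%:R.
exists N, (fun i => tau (e i) 0%N) => a; apply/funext => k.
have tau0 : tau (fun=> 0) = (fun=> 0).
  have := linear_lincomb tauL [::] (fun _ : nat => 0) (fun=> 0).
  by rewrite !big_nil.
(* Letter [k] of the image of [a] is letter [0] of the image of the shifted sequence [b], which is
   then truncated to its first [N] letters, [tb]. *)
rewrite -[k in LHS]add0n (@CAT_shift _ tau) //.
rewrite fct_sumE; pose b i := a (i + k)%N.
pose tb : nat -> F^o := \sum_(0 <= i < N) b i *: e i.
have tbE i : (i < N)%N -> tb i = b i.
  move=> iN; rewrite /tb fct_sumE (bigD1_seq i) ?mem_index_iota ?iota_uniq //=.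
  rewrite [X in _ + X]big1 ?addr0 => [|j ji].
    by rewrite /= -[LHS]/(b i * (i == i)%:R) eqxx mulr1.
  by rewrite -[LHS]/(b j * (i == j)%:R) eq_sym (negbTE ji) mulr0.
have -> : tau b 0%N = tau tb 0%N.
  (* The difference [d] vanishes on the window, so its image has letter [0] equal to zero. *)
  pose d : nat -> F^o := (-1) *: (tb : nat -> F^o) + (b : nat -> F^o).
  have : tau d 0%N = 0.
    rewrite -[RHS]/((fun=> 0 : F) 0%N) -tau0 tauN // => i iN.
    by rewrite -[LHS]/(-1 * tb i + b i) tbE // mulN1r addNr.
  by rewrite tauL -[LHS]/(-1 * tau tb 0%N + tau b 0%N) mulN1r addrC =>
    /subr0_eq.
rewrite (linear_lincomb tauL) fct_sumE; apply: eq_bigr => i _.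
by rewrite -[LHS]/(b i * tau (e i) 0%N) mulrC /b addnC.
Qed.

Lemma LCAT_comm (F : finFieldType) : commutative_family (@LCAT F).
Proof.
move=> tau mu /LCAT_poly_shift[N [c tauE]] [muC muL].
apply/funext => a /=; rewrite [RHS](congr1 mu (tauE a)) tauE (linear_lincomb muL).
apply: eq_bigr => i _; apply: (congr1 (fun x : nat -> F^o => c i *: x)).
by apply/funext => k; rewrite (@CAT_shift _ mu).
Qed.

Lemma LCAT_comp (F : finFieldType) : semigroup (@LCAT F).
Proof.
move=> tau mu [[tauC tauS] tauL] [[muC muS] muL]; split; last first.
  by move=> c u v /=; rewrite muL tauL.
split=> [a|]; first exact: continuous_comp (muC a) (tauC (mu a)).
by rewrite -compA muS compA tauS.
Qed.

(** These automata suffice as tests: commuting with all of them already forces linearity of a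
    cellular automaton. *)
Lemma LCAT_scale_add_shift (F : finFieldType) (c : F) j :
  @LCAT F (fun a i => c * a i + a (i + j)%N).
Proof.
split; last first.
  move=> d u v; apply/funext => i; rewrite -[LHS]/(c * (d * u i + v i)
    + (d * u (i + j)%N + v (i + j)%N)) -[RHS]/(d * (c * u i + u (i + j)%N)
    + (c * v i + v (i + j)%N)).
  by rewrite !mulrDr addrACA !(mulrCA c).
split=> //; apply/continuous_configP => a k.
exists (k + j).+1 => b eqb; rewrite !eqb //.
by rewrite ltnS leq_addr.
Qed.

Lemma LCAT_commutant_linear (F : finFieldType) (mu : config F -> config F) :
  CAT mu -> (forall tau, LCAT tau -> mu \o tau = tau \o mu) -> LCAT mu.
Proof.
move=> muC mu_comm; split=> // c u v; apply/funext => k.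
have loc := (continuous_configP mu).1 muC.1.
(* Two windows for letter [k]: [M] permits replacing [w] by [u], and [N] permits replacing
   [c w + sigma^j w] by [c u + v]; [j] must cover both. *)
have [M uM] := loc u k; have [N uvN] := loc (c *: u + v) k.
pose j := maxn M N.
pose w : config F := fun i => if (i < j)%N then u i else v (i - j)%N.
have := congr1 (fun f => f w k) (mu_comm _ (LCAT_scale_add_shift c j)).
rewrite /= (@CAT_shift _ mu) //.
have -> : (fun i => w (i + j)%N) = v.
  by apply/funext => i; rewrite /w ltnNge leq_addl addnK.
rewrite (uM w) => [|i iM]; last by rewrite /w leq_max iM.
rewrite uvN => [|i iN]; first by [].
by rewrite /w [(i < j)%N]leq_max iN orbT ltnNge leq_addl addnK.
Qed.

Local Close Scope ring_scope.
Local Close Scope classical_set_scope.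

Theorem theorem3p3 (p m : nat) (F : finFieldType)
  (hp : prime p) (hm : 1 <= m) (hF : #|F| = p ^ m) :
  maximal_commutative (@LCAT F).
Proof.
split; [by move=> tau [] | exact: LCAT_comp | exact: LCAT_comm |].
exact: LCAT_commutant_linear.
Qed.
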